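(* Let $\kappa\in(0,1/2)$. There is a constant $C>0$, depending only on $\kappa$, such that the following holds. Let $n\ge1$, $x_1,\dots,x_n\in\mathbb{T}^2$, $r_1,\dots,r_n\in(0,1/4)$ and $\varepsilon\in(0,1/4)$. If the set $$R_{x_1,r_1}\circ\cdots\circ R_{x_n,r_n}\big((0,1/2)^2\big)\subset\mathbb{T}^2$$ is mixed at scale $\varepsilon$ with mixing constant $\kappa$, then $$\sum_{i=1}^n r_i^2\ge C^{-1}\log\varepsilon^{-1}.$$
   Context: $\mathbb{T}^2=\mathbb{R}^2/\mathbb{Z}^2$ with its usual geodesic distance and Lebesgue measure; $B_r(x)$ is the ball of radius $r$ centered at $x$. For $x\in\mathbb{T}^2$ and $r\in(0,1/4)$, $R_{x,r}:\mathbb{T}^2\to\mathbb{T}^2$ is the map which rotates the square $(x_1-r,x_1+r)\times(x_2-r,x_2+r)$ by $90^\circ$ counter-clockwise about its center: $$R_{x,r}(y)=\begin{cases}(x_1+x_2-y_2,\ x_2-x_1+y_1)&\text{if }y-x\in(-r,r)^2,\\ y&\text{otherwise,}\end{cases}$$ with coordinates understood modulo $\mathbb{Z}^2$ (the condition and formula use representatives with $y-x\in[-1/2,1/2)^2$). A measurable set $E\subset\mathbb{T}^2$ is mixed at scale $r$ (where $0<r<1/4$) with mixing constant $\kappa\in(0,1/2)$ if $$\kappa\le\frac{|E\cap B_r(x)|}{|B_r(x)|}\le1-\kappa\qquad\text{for all }x\in\mathbb{T}^2.$$ *)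

(* Defs.v *)
From HB Require Import structures.
From mathcomp Require Import all_boot all_order all_algebra ring_quotient.
From mathcomp Require Import all_classical all_reals all_analysis.

Set Implicit Arguments.
Unset Strict Implicit.
Unset Printing Implicit Defensive.

Import Order.TTheory GRing.Theory Num.Theory.
Import numFieldNormedType.Exports.

Local Open Scope classical_set_scope.
Local Open Scope ring_scope.
Local Open Scope quotient_scope.

(* R * R with the sigma-algebra on which [lebesgue_measure \x lebesgue_measure]
   is a measure. *)
Local Notation plane R := (measurableTypeR R * measurableTypeR R)%type.

Definition int_lattice (R : realType) : {pred R * R} :=
  [pred v | (v.1 \is a Num.int) && (v.2 \is a Num.int)].

Lemma int_lattice_zmod_closed (R : realType) : zmod_closed (@int_lattice R).
Proof.
split=> [|u v /andP[u1 u2] /andP[v1 v2]]; first by rewrite inE /= !rpred0.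
by rewrite inE /= !rpredB.
Qed.

HB.instance Definition _ (R : realType) :=
  GRing.isZmodClosed.Build (R * R)%type (@int_lattice R)
    (@int_lattice_zmod_closed R).

Definition torus (R : realType) : Type := Quotient.quot (@int_lattice R).
HB.instance Definition _ (R : realType) := ZmodQuotient.on (torus R).
HB.instance Definition _ (R : realType) := isPointed.Build (torus R) 0.

Definition torus_pi (R : realType) (v : R * R) : torus R := \pi_(torus R) v.

(* The Borel sigma-algebra of the quotient: it is the image of that of R * R. *)
Definition torus_measurable (R : realType) : set (set (torus R)) :=
  image_set_system setT
    (@torus_pi R : plane R -> torus R) measurable.

Lemma torus_sigma_algebra (R : realType) :
  sigma_algebra setT (@torus_measurable R).
Proof. exact/sigma_algebra_image/sigma_algebra_measurable. Qed.

Lemma torus_measurableC (R : realType) (A : set (torus R)) :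
  torus_measurable A -> torus_measurable (~` A).
Proof. by case: (torus_sigma_algebra R) => _ + _; rewrite -setTD; apply. Qed.

Lemma torus_measurable0 (R : realType) : torus_measurable (@set0 (torus R)).
Proof. by case: (torus_sigma_algebra R). Qed.

Lemma torus_measurable_bigcup (R : realType) (F : (set (torus R))^nat) :
  (forall i, torus_measurable (F i)) -> torus_measurable (\bigcup_i (F i)).
Proof. by case: (torus_sigma_algebra R) => _ _; apply. Qed.

Fact torus_display : measure_display. Proof. by []. Qed.

HB.instance Definition _ (R : realType) :=
  @isMeasurable.Build torus_display (torus R) (@torus_measurable R)
    (@torus_measurable0 R) (@torus_measurableC R) (@torus_measurable_bigcup R).

Lemma measurable_torus_pi (R : realType) :
  measurable_fun setT
    (@torus_pi R : plane R -> torus R).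
Proof. by move=> _ A. Qed.

Definition fundamental_square (R : realType) :
    set (plane R) :=
  `[0%R, 1%R[%classic `*` `[0%R, 1%R[%classic.

Lemma measurable_fundamental_square (R : realType) :
  measurable (@fundamental_square R).
Proof. by apply: measurableX; exact: measurable_itv. Qed.

Definition torus_measure (R : realType) : set (torus R) -> \bar R :=
  pushforward
    (mrestr (@lebesgue_measure R \x @lebesgue_measure R)%E
       (@measurable_fundamental_square R))
    (@torus_pi R : plane R -> torus R).

Lemma torus_measure0 (R : realType) : @torus_measure R set0 = 0%E.
Proof. by rewrite /torus_measure /pushforward preimage_set0 measure0. Qed.

Lemma torus_measure_ge0 (R : realType) (A : set (torus R)) :
  (0 <= torus_measure A)%E.
Proof. exact: measure_ge0. Qed.

Lemma torus_measure_sigma_additive (R : realType) :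
  semi_sigma_additive (@torus_measure R).
Proof.
have mpi (A : set (torus R)) : measurable A ->
    measurable (@torus_pi R @^-1` A : set (plane R)).
  by move=> mA; rewrite -[X in measurable X]setTI; exact: measurable_torus_pi.
move=> F mF tF mUF; rewrite /torus_measure /pushforward preimage_bigcup.
apply: measure_semi_sigma_additive.
- by move=> n; exact: mpi.
- apply/trivIsetP => /= i j _ _ ij; rewrite -preimage_setI.
  by move/trivIsetP : tF => /(_ _ _ _ _ ij) ->//; rewrite preimage_set0.
- by rewrite -preimage_bigcup; exact: mpi.
Qed.

HB.instance Definition _ (R : realType) :=
  isMeasure.Build _ _ _ (@torus_measure R) (@torus_measure0 R)
    (@torus_measure_ge0 R) (@torus_measure_sigma_additive R).

(* The norm of the library on R * R is the sup norm. *)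
Definition euclidean_norm (R : realType) (v : R * R) : R :=
  Num.sqrt (v.1 ^+ 2 + v.2 ^+ 2).

(* Geodesics of the flat torus are projections of straight segments, so the
   distance is the least length of a vector of R^2 projecting to y - x. *)
Definition torus_dist (R : realType) (x y : torus R) : R :=
  inf [set euclidean_norm v | v in [set v | torus_pi v = y - x]].

Definition torus_ball (R : realType) (x : torus R) (r : R) : set (torus R) :=
  [set y | torus_dist x y < r].

(* The representative of t in [-1/2, 1/2)^2. *)
Definition centered_repr (R : realType) (t : torus R) : R * R :=
  let v := repr t in
  (v.1 - (Num.floor (v.1 + 2^-1))%:~R, v.2 - (Num.floor (v.2 + 2^-1))%:~R).

(* [xr] and [yr] are representatives of x and y with yr - xr in
   [-1/2, 1/2)^2; the value does not depend on the choice of xr. *)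
Definition rotate_square (R : realType) (x : torus R) (r : R) (y : torus R) :
    torus R :=
  let d := centered_repr (y - x) in
  let xr := repr x in
  let yr := xr + d in
  if (- r < d.1 < r) && (- r < d.2 < r)
  then torus_pi (xr.1 + xr.2 - yr.2, xr.2 - xr.1 + yr.1)
  else y.

Definition half_square (R : realType) : set (torus R) :=
  @torus_pi R @` (`]0%R, 2^-1%R[%classic `*` `]0%R, 2^-1%R[%classic).

(* The sigma-algebra is the Borel one.  This costs no generality for the images
   of [half_square] under compositions of [rotate_square x r]: each of these
   maps is a bijection that is piecewise isometric on Borel pieces (at least for
   r <= 1/2), so that such images are Borel. *)
Definition mixed (R : realType) (kappa r : R) (E : set (torus R)) : Prop :=
  measurable E /\
  forall x : torus R,
    kappa <= fine (torus_measure (E `&` torus_ball x r)) /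
             fine (torus_measure (torus_ball x r)) <= 1 - kappa.

(* Main.v *)
(* Let d(z) be the density of A in the open square of half-side s centred at z,
   and let V(A, s) be the integral of d (1 - d) over the torus.  Lower bounds on d
   valid for all z pass from s to 2 s, because a square is made of four squares of
   half its size; hence a set mixed at scale eps has V >= (kappa / 4)^2 at all
   scales 2^j eps <= 1/4, while the initial square has V <= 8 s.

   A quarter turn maps squares to squares.  Rotating the square of centre x and
   half-side r therefore permutes the squares of half-side s contained in it, and
   keeps the mass of those that contain it or are disjoint from it.  The remaining
   centres z satisfy |r - s| <= |z - x| < r + s in sup norm, which is a set of area
   16 r s, and there d changes by at most min(1, r^2 / s^2).  Summed over dyadic
   scales, one rotation increases V by at most 96 r^2, so that
   N (kappa / 4)^2 <= 4 + 96 sum r_i^2, where N is the number of scales.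

   The additive constant only matters when eps is bounded below.  Then it suffices
   that the density at (3/4, 3/4) and scale eps, initially 0, has become at least
   kappa / 4, although each rotation increases it by at most r^2 / eps^2. *)
Require Import Defs.
From HB Require Import structures.
From mathcomp Require Import all_boot all_order all_algebra ring_quotient.
From mathcomp Require Import all_classical all_reals all_analysis.
From mathcomp Require Import measurable_realfun zify ring lra.

Import Order.TTheory GRing.Theory Num.Theory.
Import numFieldNormedType.Exports.

Set Implicit Arguments.
Unset Strict Implicit.
Unset Printing Implicit Defensive.

Local Open Scope classical_set_scope.
Local Open Scope ring_scope.

Local Notation plane R := (measurableTypeR R * measurableTypeR R)%type.
Local Notation area R := (@lebesgue_measure R \x @lebesgue_measure R)%E.

(** * Measure-preserving maps of the plane *)

Definition measure_preserving {d} {T : measurableType d} {R : realType}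
    (mu : set T -> \bar R) (phi : T -> T) : Prop :=
  measurable_fun setT phi /\
  forall A, measurable A -> mu (phi @^-1` A) = mu A.

Lemma measurable_preimage {d d'} {T : measurableType d} {T' : measurableType d'}
    (phi : T -> T') (A : set T') :
  measurable_fun setT phi -> measurable A -> measurable (phi @^-1` A).
Proof. by move=> mphi mA; rewrite -[X in measurable X]setTI; exact: mphi. Qed.

Lemma ge0_integral_measure_preserving {d} {T : measurableType d} {R : realType}
    (mu : {measure set T -> \bar R}) (phi : T -> T) (D : set T)
    (f : T -> \bar R) :
  measure_preserving mu phi -> measurable D -> measurable_fun D f ->
  (forall x, 0 <= f x)%E ->
  (\int[mu]_(x in phi @^-1` D) f (phi x) = \int[mu]_(x in D) f x)%E.
Proof.
move=> [mphi pphi] mD mf f0.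
rewrite -(ge0_integral_pushforward mphi)//.
by apply: eq_measure_integral => A mA _; exact: pphi.
Qed.

Section line.
Context (R : realType).
Local Notation lam := (@lebesgue_measure R).

(** Lebesgue measure is the only measure giving each interval []u, v]] its length, so the
    pushforward need only be computed on these intervals. *)
Lemma measure_preserving_addr (a : R) :
  measure_preserving lam (fun x : measurableTypeR R => x + a : measurableTypeR R).
Proof.
have ma : measurable_fun setT (fun x : measurableTypeR R => x + a : measurableTypeR R).
  exact: measurable_funD.
split=> // A mA.
rewrite -[LHS]/(pushforward lam
  (fun x : measurableTypeR R => x + a : measurableTypeR R) A).
apply/esym/lebesgue_measure_unique => //= _ [[u v]] _ <-.
rewrite /pushforward (_ : _ @^-1` _ = `](u - a), (v - a)]%classic); last first.
  by apply/seteqP; split=> x /=; rewrite !in_itv/= ltrBlDr lerBrDr.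
rewrite !lebesgue_measure_itv/= !lte_fin ltrD2r.
by case: ifP => // _; rewrite -!EFinB; congr EFin; ring.
Qed.

Lemma measure_preserving_subl (a : R) :
  measure_preserving lam (fun x : measurableTypeR R => a - x : measurableTypeR R).
Proof.
have ma : measurable_fun setT (fun x : measurableTypeR R => a - x : measurableTypeR R).
  exact: measurable_funB.
split=> // A mA.
rewrite -[LHS]/(pushforward lam
  (fun x : measurableTypeR R => a - x : measurableTypeR R) A).
apply/esym/lebesgue_measure_unique => //= _ [[u v]] _ <-.
(* The reflection moves the closed end to the other side, which does not affect the length. *)
rewrite /pushforward (_ : _ @^-1` _ = `[(a - v), (a - u)[%classic); last first.
  by apply/seteqP; split=> x /=; rewrite !in_itv/=; lra.
rewrite !lebesgue_measure_itv/= !lte_fin ltrD2l ltrN2.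
by case: ifP => // _; rewrite -!EFinB; congr EFin; ring.
Qed.

End line.

Section plane_maps.
Context (R : realType).
Local Notation lam := (@lebesgue_measure R).

Lemma measure_preserving_prod (f g : measurableTypeR R -> measurableTypeR R) :
  measure_preserving lam f -> measure_preserving lam g ->
  measure_preserving (area R) (fun z : plane R => (f z.1, g z.2)).
Proof.
move=> [mf pf] [mg pg].
have m : measurable_fun setT (fun z : plane R => (f z.1, g z.2)).
  by apply: measurable_fun_pair; apply: measurableT_comp.
split=> // A mA.
rewrite -[LHS]/(pushforward (area R) (fun z : plane R => (f z.1, g z.2)) A).
apply/esym/product_measure_unique => //= B C mB mC.
have mfB := measurable_preimage mf mB; have mgC := measurable_preimage mg mC.
rewrite /pushforward (_ : _ @^-1` _ = (f @^-1` B) `*` (g @^-1` C))//.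
by rewrite (product_measure1E _ _ mfB mgC) /= pf// pg.
Qed.

(** A quarter turn exchanges the coordinates. As for products of maps, rectangles determine the
    measure. *)
Lemma measure_preserving_swap (f g : measurableTypeR R -> measurableTypeR R) :
  measure_preserving lam f -> measure_preserving lam g ->
  measure_preserving (area R) (fun z : plane R => (f z.2, g z.1)).
Proof.
move=> [mf pf] [mg pg].
have m : measurable_fun setT (fun z : plane R => (f z.2, g z.1)).
  by apply: measurable_fun_pair; apply: measurableT_comp.
split=> // A mA.
rewrite -[LHS]/(pushforward (area R) (fun z : plane R => (f z.2, g z.1)) A).
apply/esym/product_measure_unique => //= B C mB mC.
have mfB := measurable_preimage mf mB; have mgC := measurable_preimage mg mC.
rewrite /pushforward (_ : _ @^-1` _ = (g @^-1` C) `*` (f @^-1` B)); last first.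
  by apply/seteqP; split=> z [].
by rewrite (product_measure1E _ _ mgC mfB) /= pf// pg// muleC.
Qed.

End plane_maps.

(** * Integrals of periodic functions over fundamental domains *)

Section shift_period.
Local Open Scope ereal_scope.
Context d (T : measurableType d) (R : realType) (mu : {measure set T -> \bar R}).
Variables (p : T -> R) (tau : int -> T -> T) (J : set T) (f : T -> \bar R).
Hypotheses (mp : measurable_fun setT p)
  (tau_mu : forall n, measure_preserving mu (tau n))
  (p_tau : forall n z, p (tau n z) = (p z + n%:~R)%R)
  (mJ : measurable J) (J_tau : forall n z, J (tau n z) <-> J z)
  (mf : measurable_fun setT f) (f0 : forall z, 0 <= f z)
  (f_tau : forall n z, f (tau n z) = f z).

Let S (u v : R) : set T := p @^-1` `[u, v[%classic `&` J.

Let mS u v : measurable (S u v).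
Proof. by apply: measurableI => //; apply: measurable_preimage. Qed.

Let integral_S_split (u v w : R) : (u <= v)%R -> (v <= w)%R ->
  \int[mu]_(z in S u w) f z = \int[mu]_(z in S u v) f z + \int[mu]_(z in S v w) f z.
Proof.
move=> uv vw; rewrite -ge0_integral_setU//; last 2 first.
- exact: measurable_funS mf.
- rewrite disj_set2E; apply/eqP/seteqP; split=> // z [[/= + _] [/= + _]].
  by rewrite !in_itv/=; lra.
congr (integral _ _ _); apply/seteqP; split=> z; rewrite /S/= !in_itv/=.
  move=> [pz Jz]; have [pv|pv] := ltP (p z) v; [left|right]; split=> //; lra.
by move=> [] [pz Jz]; split=> //; lra.
Qed.

Let integral_S_shift (n : int) (u v : R) :
  \int[mu]_(z in S u v) f z = \int[mu]_(z in S (u - n%:~R) (v - n%:~R)) f z.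
Proof.
rewrite -(ge0_integral_measure_preserving (tau_mu n))//; last exact: measurable_funS mf.
under eq_integral do rewrite f_tau.
congr (integral _ _ _); apply/seteqP; split=> z; rewrite /S/= !in_itv/= p_tau.
  by move=> [pz /J_tau Jz]; split=> //; lra.
by move=> [pz Jz]; split; [lra|exact/J_tau].
Qed.

(** With [m] the floor of [u], cutting at [m + 1] and translating the pieces by [- m] and
    [- (m + 1)] yields [[u - m, 1[] and [[0, u - m[], which together fill [[0, 1[]. In the
    applications [p] is one coordinate, [J] restricts the other one, and [tau] translates along
    [p]. *)
Lemma integral_shift_period (u : R) :
  \int[mu]_(z in p @^-1` `[u, (u + 1)%R[%classic `&` J) f z =
  \int[mu]_(z in p @^-1` `[0%R, 1%R[%classic `&` J) f z.
Proof.
have /andP[] := floor_itv u; set m := Num.floor u; rewrite intrD => m_le m_gt.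
rewrite -/(S _ _) -/(S _ _).
rewrite (@integral_S_split u (m%:~R + 1) (u + 1)); [|lra|lra].
rewrite (integral_S_shift m u) (integral_S_shift (m + 1)%R (_ + 1)) intrD.
have e1 : ((m%:~R : R) + 1 - m%:~R = 1)%R by ring.
have e2 : (u + 1 - (m%:~R + 1%:~R) = u - m%:~R)%R by ring.
rewrite e1 e2 subrr addeC -integral_S_split//; lra.
Qed.

End shift_period.

Section fundamental_domains.
Context (R : realType).

(** The codomain is arbitrary so that functions and sets, as functions into [Prop], are covered
    alike. *)
Definition lattice_periodic (V : Type) (f : plane R -> V) : Prop :=
  forall (m n : int) (z : plane R), f (z.1 + m%:~R, z.2 + n%:~R) = f z.

Definition unit_square (a : plane R) : set (plane R) :=
  `[a.1, a.1 + 1[%classic `*` `[a.2, a.2 + 1[%classic.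

Lemma measurable_unit_square (a : plane R) : measurable (unit_square a).
Proof. by apply: measurableX; exact: measurable_itv. Qed.

Lemma measure_preserving_translate (a : plane R) :
  measure_preserving (area R) (fun z : plane R => (z.1 + a.1, z.2 + a.2) : plane R).
Proof.
exact: (measure_preserving_prod (@measure_preserving_addr R a.1)
  (@measure_preserving_addr R a.2)).
Qed.

Lemma integral_unit_square (f : plane R -> \bar R) (a : plane R) :
  measurable_fun setT f -> (forall z, 0 <= f z)%E -> lattice_periodic f ->
  (\int[area R]_(z in unit_square a) f z =
   \int[area R]_(z in @fundamental_square R) f z)%E.
Proof.
move=> mf f0 fp; pose I : set (measurableTypeR R) := `[0, 1[%classic.
pose J : set (measurableTypeR R) := `[a.2, a.2 + 1[%classic.
have e (A B : set (measurableTypeR R)) : A `*` B = fst @^-1` A `&` snd @^-1` B.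
  by apply/seteqP; split.
(* The coordinates are moved one at a time: first the abscissa, with the ordinate still in [J]. *)
transitivity (\int[area R]_(z in I `*` J) f z)%E.
  rewrite /unit_square !e.
  apply: (@integral_shift_period _ (plane R) R (area R) fst
    (fun n z => (z.1 + n%:~R, z.2) : plane R)) => //.
  - move=> n; have := measure_preserving_translate (n%:~R, 0).
    by under eq_fun do rewrite /= addr0.
  - by apply: measurable_preimage => //; exact: measurable_itv.
  - by move=> n z; rewrite -[RHS](fp n 0) addr0.
rewrite /fundamental_square !e setIC [in RHS]setIC.
apply: (@integral_shift_period _ (plane R) R (area R) snd
    (fun n z => (z.1, z.2 + n%:~R) : plane R)) => //.
- move=> n; have := measure_preserving_translate (0, n%:~R).
  by under eq_fun do rewrite /= addr0.
- by apply: measurable_preimage => //; exact: measurable_itv.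
- by move=> n z; rewrite -[RHS](fp 0 n) addr0.
Qed.

Lemma area_unit_square (A : set (plane R)) (a : plane R) :
  measurable A -> lattice_periodic A ->
  area R (A `&` unit_square a) = area R (A `&` @fundamental_square R).
Proof.
move=> mA pA.
have mf : measurable_fun setT (fun z => (\1_A z)%:E : \bar R).
  by apply/measurable_EFinP; exact: measurable_indic.
have mU := measurable_unit_square a.
have mF := @measurable_fundamental_square R.
have int_indic D : measurable D ->
    (\int[area R]_(z in D) (\1_A z)%:E = area R (A `&` D))%E.
  by move=> mD; rewrite integral_indic.
rewrite -(int_indic _ mU) -(int_indic _ mF).
apply: integral_unit_square; [exact: mf|by move=> z; rewrite lee_fin|move=> m n z].
by rewrite !indicE; congr ((nat_of_bool _)%:R%:E); apply/idP/idP; rewrite !inE pA.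
Qed.

End fundamental_domains.

(** * Lifting rotations to the plane *)

Section torus_lift.
Context (R : realType).
Implicit Types (t : R) (u v w : R * R).
Local Open Scope quotient_scope.

Lemma torus_piB u v : torus_pi (u - v) = torus_pi u - torus_pi v.
Proof. exact: (raddfB \pi_(torus R)). Qed.

Lemma torus_piP u v : torus_pi u = torus_pi v <->
  exists m n : int, u = (v.1 + m%:~R, v.2 + n%:~R).
Proof.
split=> [/eqP|[m [n ->]]].
  rewrite /torus_pi -Quotient.idealrBE => /andP[/intrP[m em] /intrP[n en]].
  exists m, n; rewrite [LHS]surjective_pairing -em -en.
  by congr pair; rewrite addrC subrK.
apply/eqP; rewrite /torus_pi -Quotient.idealrBE.
apply/andP; split; rewrite /= addrAC subrr add0r; exact: intr_int.
Qed.

Lemma torus_pi_addz (m n : int) v : torus_pi (v.1 + m%:~R, v.2 + n%:~R) = torus_pi v.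
Proof. by apply/torus_piP; exists m, n. Qed.

Lemma torus_pi_repr (x : torus R) : torus_pi (repr x) = x.
Proof. exact: reprK. Qed.

Definition centered t : R := t - (Num.floor (t + 2^-1))%:~R.

Lemma centered_ge t : - 2^-1 <= centered t.
Proof. by rewrite /centered; have /andP[] := floor_itv (t + 2^-1); lra. Qed.

Lemma centered_lt t : centered t < 2^-1.
Proof. by rewrite /centered; have /andP[] := floor_itv (t + 2^-1); rewrite intrD; lra. Qed.

Lemma centeredDz t (n : int) : centered (t + n%:~R) = centered t.
Proof.
rewrite /centered (_ : t + n%:~R + 2^-1 = t + 2^-1 + n%:~R); last by rewrite addrAC.
by rewrite floorDrz ?intr_int// intrKfloor intrD; ring.
Qed.

Lemma centered_id t : - 2^-1 <= t -> t < 2^-1 -> centered t = t.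
Proof.
move=> t1 t2; rewrite /centered (@floor_def _ _ 0) ?subr0//.
by rewrite add0r; lra.
Qed.

Lemma centeredE t : exists n : int, t = centered t + n%:~R.
Proof. by exists (Num.floor (t + 2^-1)); rewrite /centered subrK. Qed.

Lemma measurable_centered : measurable_fun setT (centered : measurableTypeR R -> measurableTypeR R).
Proof.
apply: measurable_funB => //.
apply: nondecreasing_measurable => // s t st.
by rewrite ler_int; apply: le_floor; rewrite lerD2r.
Qed.

Lemma centered_repr_pi v : centered_repr (torus_pi v) = (centered v.1, centered v.2).
Proof.
have /torus_piP[m [n e]] := torus_pi_repr (torus_pi v).
by rewrite /centered_repr e /= -/(centered _) -/(centered _) !centeredDz.
Qed.

Definition in_square (r : R) v : bool := (- r < v.1 < r) && (- r < v.2 < r).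

(* The sign [c] selects the counter-clockwise ([c = 1]) or the clockwise
   ([c = -1]) rotation, so that one definition covers a lift and its inverse. *)
Definition rotate_lift (c : R) (x : R * R) (r : R) (y : plane R) : plane R :=
  let d := (centered (y.1 - x.1), centered (y.2 - x.2)) in
  if in_square r d then (y.1 - d.1 - c * d.2, y.2 - d.2 + c * d.1) else y.

(** The lift turns about [y - d], the translate of the centre seen from [y], instead of about
    [repr x]; the two results differ by a lattice vector. *)
Lemma rotate_square_pi (x : torus R) r v :
  rotate_square x r (torus_pi v) = torus_pi (rotate_lift 1 (repr x) r v).
Proof.
have e : torus_pi v - x = torus_pi (v - repr x) by rewrite torus_piB torus_pi_repr.
rewrite /rotate_square e centered_repr_pi /rotate_lift /in_square /=; case: ifP => // _.
have [m em] := centeredE (v.1 - (repr x).1).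
have [n en] := centeredE (v.2 - (repr x).2).
move: em en; set d1 := centered _; set d2 := centered _ => em en.
apply/torus_piP; exists (- m), (- n); rewrite /= !mulrNz.
by apply/pair_equal_spec; split; lra.
Qed.

Lemma rotate_liftDz c x r (m n : int) v :
  rotate_lift c x r (v.1 + m%:~R, v.2 + n%:~R) =
  ((rotate_lift c x r v).1 + m%:~R, (rotate_lift c x r v).2 + n%:~R).
Proof.
rewrite /rotate_lift /= (addrAC v.1) (addrAC v.2) !centeredDz.
by case: ifP => //= _; apply/pair_equal_spec; split; ring.
Qed.

(** A quarter turn in either direction preserves the square of half-side [r], and for [r < 4^-1] the
    turned offset is its own centred representative, so the opposite turn undoes it. Allowing both
    signs yields a two-sided inverse. *)
Lemma rotate_liftK c x r : c = 1 \/ c = -1 -> r < 4^-1 ->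
  cancel (rotate_lift c x r) (rotate_lift (- c) x r).
Proof.
move=> c1 r4 v; rewrite [rotate_lift c x r v]/rotate_lift.
have [m em] := centeredE (v.1 - x.1); have [n en] := centeredE (v.2 - x.2).
move: em en; set d1 := centered _; set d2 := centered _ => em en.
case: ifPn => [/andP[/= d1r d2r]|/negbTE h]; last first.
  by rewrite /rotate_lift -/d1 -/d2 h.
rewrite /rotate_lift /=.
rewrite (_ : _ - x.1 = - c * d2 + m%:~R)/=; last by lra.
rewrite (_ : _ - x.2 = c * d1 + n%:~R)/=; last by lra.
have [b1 b2] : - r < - c * d2 < r /\ - r < c * d1 < r by case: c1 => ->; lra.
rewrite !centeredDz (@centered_id (- c * d2)) ?(@centered_id (c * d1)); [|lra..].
rewrite /in_square/= b1 b2 /=.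
rewrite [RHS]surjective_pairing.
by apply/pair_equal_spec; case: c1 => ->; split; lra.
Qed.

Lemma measurable_rotate_lift c x r : measurable_fun setT (rotate_lift c x r).
Proof.
have md1 : measurable_fun setT (fun y : plane R => centered (y.1 - x.1) : measurableTypeR R).
  by apply: measurableT_comp => //; [exact: measurable_centered|exact: measurable_funB].
have md2 : measurable_fun setT (fun y : plane R => centered (y.2 - x.2) : measurableTypeR R).
  by apply: measurableT_comp => //; [exact: measurable_centered|exact: measurable_funB].
apply: measurable_fun_if => //.
- by apply: measurable_and; apply: measurable_and; exact: measurable_fun_ltr.
- apply: measurable_funTS; apply: measurable_fun_pair.
    by apply: measurable_funB => //; [exact: measurable_funB|exact: measurable_funM].
  by apply: measurable_funD => //; [exact: measurable_funB|exact: measurable_funM].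
Qed.

(** Preimages under the inverse lift replace images: they are measurable and commute with
    intersections. From here on the rotated set is handled through [rotate_lift (- 1)]. *)
Lemma preimage_rotate_square (E : set (torus R)) (x : torus R) r : r < 4^-1 ->
  @torus_pi R @^-1` (rotate_square x r @` E) =
  rotate_lift (- 1) (repr x) r @^-1` (@torus_pi R @^-1` E).
Proof.
move=> r4; apply/seteqP; split=> y /=.
  move=> [t Et]; rewrite -{1}(torus_pi_repr t) rotate_square_pi => /torus_piP[m [n e]].
  have := @rotate_liftK 1 (repr x) r (or_introl erefl) r4 (repr t).
  rewrite e rotate_liftDz => e'.
  by rewrite -(torus_pi_addz m n) e' torus_pi_repr.
move=> Ey; exists (torus_pi (rotate_lift (-1) (repr x) r y)) => //.
rewrite rotate_square_pi; have := @rotate_liftK (-1) (repr x) r (or_intror erefl) r4 y.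
by rewrite opprK => ->.
Qed.

End torus_lift.

(** * The multiscale mixing cost *)

Section density.
Context (R : realType).
Implicit Types (A B : set (plane R)) (z y : plane R) (s : R).

Definition box z s : set (plane R) :=
  `]z.1 - s, z.1 + s[%classic `*` `]z.2 - s, z.2 + s[%classic.

Lemma boxE z s y : box z s y <->
  (z.1 - s < y.1 < z.1 + s) /\ (z.2 - s < y.2 < z.2 + s).
Proof. by rewrite /box /= !in_itv. Qed.

Lemma measurable_box z s : measurable (box z s).
Proof. by apply: measurableX; exact: measurable_itv. Qed.

Lemma area_box z s : 0 <= s -> area R (box z s) = (4 * s ^+ 2)%:E.
Proof.
move=> s0; rewrite /box product_measure1E//= !lebesgue_measure_itv/= !lte_fin.
have ts (t : R) : (t - s < t + s) = (0 < s) by apply/idP/idP; lra.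
rewrite !ts; case: ltgtP s0 => // [_|<-] _; last by rewrite mul0e expr0n mulr0.
by rewrite -!EFinB -EFinM; congr EFin; ring.
Qed.

Lemma sigma_finite_area : sigma_finite [set: plane R] (area R).
Proof.
exists (fun n => box (0, 0) n%:R).
  apply/esym/seteqP; split=> // y _; exists (Num.trunc (Num.max `|y.1| `|y.2|)).+1 => //.
  have : Num.max `|y.1| `|y.2| < (Num.trunc (Num.max `|y.1| `|y.2|)).+1%:R.
    by apply: truncnS_gt.
  by rewrite gt_max !ltr_norml => h; apply/boxE => /=; lra.
move=> n; split; first exact: measurable_box.
by rewrite area_box// ltry.
Qed.

Lemma fin_num_area_box A z s : measurable A -> area R (A `&` box z s) \is a fin_num.
Proof.
move=> mA; rewrite ge0_fin_numE ?measure_ge0//.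
(* No sign is assumed on [s]: the box is empty for negative [s], and its absolute value gives a
   larger box in all cases. *)
apply: (@le_lt_trans _ _ (area R (box z `|s|))); last by rewrite area_box// ltry.
apply: le_measure; rewrite ?inE; [|exact: measurable_box|].
  by apply: measurableI => //; exact: measurable_box.
by move=> y [_] /boxE h; apply/boxE; have := ler_norm s; lra.
Qed.

Definition density A s z : R := fine (area R (A `&` box z s)) / (4 * s ^+ 2).

Lemma density_ge0 A s z : 0 <= density A s z.
Proof. by rewrite divr_ge0 ?fine_ge0 ?measure_ge0// mulr_ge0// sqr_ge0. Qed.

Lemma fine_area_le A B : measurable A -> measurable B -> A `<=` B ->
  area R B \is a fin_num -> fine (area R A) <= fine (area R B).
Proof.
move=> mA mB AB fB.
have h : (area R A <= area R B)%E by apply: le_measure; rewrite ?inE.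
apply: fine_le => //; rewrite ge0_fin_numE ?measure_ge0//.
by apply: (le_lt_trans h); rewrite -ge0_fin_numE ?measure_ge0.
Qed.

Lemma density_le1 A s z : measurable A -> 0 < s -> density A s z <= 1.
Proof.
move=> mA s0; have s20 : 0 < 4 * s ^+ 2 by rewrite mulr_gt0// exprn_gt0.
rewrite ler_pdivrMr// mul1r.
rewrite -[leRHS]/(fine (4 * s ^+ 2)%:E) -(@area_box z s (ltW s0)).
apply: fine_area_le; last by rewrite area_box ?ltW.
- by apply: measurableI => //; exact: measurable_box.
- exact: measurable_box.
- exact: subIsetr.
Qed.

(** The set whose area is taken is the section at [z] of a measurable set [S] of pairs, and the
    measure of sections is a measurable function because the area is sigma-finite. *)
Lemma measurable_density A s : measurable A -> measurable_fun setT (density A s).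
Proof.
move=> mA; pose S : set (plane R * plane R) :=
  snd @^-1` A `&` ((fun p => p.2.1 - p.1.1 : measurableTypeR R) @^-1` `]-s, s[%classic
  `&` (fun p => p.2.2 - p.1.2 : measurableTypeR R) @^-1` `]-s, s[%classic).
have mS : measurable S.
  apply: measurableI; first exact: measurable_preimage.
  apply: measurableI; apply: measurable_preimage; [|exact: measurable_itv| |exact: measurable_itv].
    by apply: measurable_funB; exact: measurableT_comp.
  by apply: measurable_funB; exact: measurableT_comp.
have e z : A `&` box z s = xsection S z.
  apply/seteqP; split=> y; rewrite /xsection /= ?inE /S/= !in_itv/=.
    by move=> [Ay /boxE yb]; split=> //; lra.
  by move=> [Ay yb]; split=> //; apply/boxE; lra.
apply: measurable_funM => //.
under eq_fun do rewrite e.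
pose area_mixin := @Measure_isSigmaFinite.Build _ (plane R) R (area R) sigma_finite_area.
pose mu : {sigma_finite_measure set (plane R) -> \bar R} := HB.pack (area R) area_mixin.
have h := measurable_fun_xsection mu mS.
exact: (measurableT_comp (@fine_measurable R setT measurableT) h).
Qed.

Lemma density_preserving A s z (phi : plane R -> plane R) (w : plane R) :
  measurable A -> measure_preserving (area R) phi ->
  phi @^-1` box w s = box z s -> density (phi @^-1` A) s z = density A s w.
Proof.
move=> mA [mphi pphi] e; rewrite /density -e -preimage_setI pphi//.
by apply: measurableI => //; exact: measurable_box.
Qed.

Lemma density_periodic A s : measurable A -> lattice_periodic A ->
  lattice_periodic (density A s).
Proof.
move=> mA pA m n z.
rewrite -(@density_preserving A s z (fun y => (y.1 + m%:~R, y.2 + n%:~R)))//.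
- by congr (density _ s z); apply/seteqP; split=> y /=; rewrite pA.
- exact: (measure_preserving_translate (m%:~R, n%:~R)).
- by apply/seteqP; split=> y /=; rewrite !boxE/=; lra.
Qed.

Definition cost_density A s z : \bar R := (density A s z * (1 - density A s z))%:E.

Definition mixing_cost A s : \bar R :=
  (\int[area R]_(z in @fundamental_square R) cost_density A s z)%E.

Lemma cost_density_ge0 A s z : measurable A -> 0 < s -> (0 <= cost_density A s z)%E.
Proof. by move=> mA s0; rewrite lee_fin mulr_ge0 ?density_ge0// subr_ge0 density_le1. Qed.

Lemma measurable_cost_density A s : measurable A -> measurable_fun setT (cost_density A s).
Proof.
move=> mA; apply/measurable_EFinP; have md := measurable_density s mA.
by apply: measurable_funM => //; apply: measurable_funB.
Qed.

(** The cell of integration may thus be centred at the square being rotated. *)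
Lemma mixing_cost_unit_square A s (a : plane R) :
  measurable A -> lattice_periodic A -> 0 < s ->
  mixing_cost A s = (\int[area R]_(z in unit_square a) cost_density A s z)%E.
Proof.
move=> mA pA s0; apply/esym; apply: integral_unit_square.
- exact: measurable_cost_density.
- by move=> z; exact: cost_density_ge0.
- by move=> m n z; rewrite /cost_density density_periodic.
Qed.

End density.

(** * The effect of one rotation *)

Lemma dist_unit_le1 (R : realType) (a b : R) :
  0 <= a <= 1 -> 0 <= b <= 1 -> `|a - b| <= 1.
Proof. by move=> a01 b01; rewrite ler_norml; lra. Qed.

(** The difference factors as [(a - b) * (1 - a - b)], and the second factor has absolute value at
    most 1. *)
Lemma logistic_lipschitz (R : realType) (a b k : R) :
  0 <= a <= 1 -> 0 <= b <= 1 -> `|a - b| <= k -> a * (1 - a) <= b * (1 - b) + k.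
Proof.
move=> a01 b01 abk; rewrite -lerBlDl.
apply: le_trans abk; apply: (le_trans (ler_norm _)).
rewrite (_ : _ - _ = (a - b) * (1 - a - b)); last by ring.
by rewrite normrM ler_piMr// ler_norml; lra.
Qed.

(** A centred value of size below 1/4 and [t] of size below 3/4 force the integer between them to be
    0: in this range no other copy of the square is met. *)
Lemma centered_in_itv (R : realType) (t r : R) : r < 4^-1 -> - (3 / 4) < t < 3 / 4 ->
  (- r < centered t < r) = (- r < t < r).
Proof.
move=> r4 t34; apply/idP/idP => h; last by rewrite centered_id; lra.
have [n en] := centeredE t.
have n_lt1 : n < 1 by rewrite -(ltr_int R); lra.
have n_gtN1 : -1 < n by rewrite -(ltr_int R); lra.
have n0 : n = 0 by lia.
by move: en; rewrite n0 addr0 => ->.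
Qed.

Lemma unit_squareE (R : realType) (a z : plane R) : unit_square a z <->
  (a.1 <= z.1 < a.1 + 1) /\ (a.2 <= z.2 < a.2 + 1).
Proof. by rewrite /unit_square /= !in_itv. Qed.

Section rotation_cost.
Context (R : realType).
Variables (A : set (plane R)) (x : plane R) (r : R).
Local Notation centered_cell := (unit_square (x.1 - 2^-1, x.2 - 2^-1)).
Hypotheses (mA : measurable A).

(** When [A] is lifted from the torus, [A'] is the lift of the rotated set. The map [rot] below is
    the clockwise quarter turn of the whole plane about [x], with which the inverse lift agrees on
    the central square. *)
Let A' : set (plane R) := rotate_lift (- 1) x r @^-1` A.
Let rot (y : plane R) : plane R := (x.1 + (y.2 - x.2), x.2 - (y.1 - x.1)).

Let mA' : measurable A'.
Proof. by apply: measurable_preimage => //; exact: measurable_rotate_lift. Qed.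

(** The radius 3/4 is 1/2 + 1/4: it leaves room for a centre in the cell about [x] and a box of
    half-side at most 1/4 around that centre. *)
Lemma rotate_lift_local (y : plane R) : r < 4^-1 -> box x (3 / 4) y ->
  rotate_lift (- 1) x r y = if in_square r (y.1 - x.1, y.2 - x.2) then rot y else y.
Proof.
move=> r_lt /boxE yb.
have h1 := @centered_in_itv R (y.1 - x.1) r r_lt ltac:(lra).
have h2 := @centered_in_itv R (y.2 - x.2) r r_lt ltac:(lra).
rewrite /rotate_lift /in_square /= h1 h2; case: ifP => // /andP[y1 y2].
rewrite !centered_id; [|lra..].
by rewrite /rot; congr pair; ring.
Qed.

Lemma measure_preserving_rot : measure_preserving (area R) rot.
Proof.
have := measure_preserving_swap (@measure_preserving_addr R (x.1 - x.2))
  (@measure_preserving_subl R (x.2 + x.1)).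
congr measure_preserving; apply/funext => y.
by rewrite /rot; congr pair; ring.
Qed.

Lemma rot_box (z : plane R) (s : R) : rot @^-1` box (rot z) s = box z s.
Proof. by apply/seteqP; split=> y /=; rewrite !boxE /rot /=; lra. Qed.

Variable s : R.

(** The box misses the turned square, so the map fixes each of its points. *)
Lemma density_rotate_far (z : plane R) :
  r < 4^-1 -> s <= 4^-1 -> centered_cell z -> ~ box x (r + s) z -> density A' s z = density A s z.
Proof.
move=> r_lt s_le /unit_squareE/= zb zn; congr (fine (area R _) / _).
apply/seteqP; split=> y [Ay /boxE yb]; split; try exact/boxE; move: Ay.
  rewrite /A' /preimage /= (rotate_lift_local r_lt); last by apply/boxE; lra.
  by case: ifP => // /andP[/= h1 h2]; exfalso; apply: zn; apply/boxE; lra.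
rewrite /A' /preimage /= (rotate_lift_local r_lt); last by apply/boxE; lra.
by case: ifP => // /andP[/= h1 h2]; exfalso; apply: zn; apply/boxE; lra.
Qed.

(** The box lies in the turned square, where the map is [rot], and [rot] carries it to the box of
    the same size about [rot z]. *)
Lemma density_rotate_inside (z : plane R) : r < 4^-1 -> s <= r -> box x (r - s) z ->
  density A' s z = density A s (rot z).
Proof.
move=> r_lt sr /boxE zb.
rewrite -(density_preserving mA measure_preserving_rot (rot_box z s)).
congr (fine (area R _) / _).
apply/seteqP; split=> y [Ay /boxE yb]; split; try exact/boxE; move: Ay.
  rewrite /A' /preimage /= (rotate_lift_local r_lt) ?ifT//; last by apply/boxE; lra.
  by rewrite /in_square /=; lra.
rewrite /A' /preimage /= (rotate_lift_local r_lt) ?ifT//; last by apply/boxE; lra.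
by rewrite /in_square /=; lra.
Qed.

Let area_split (B : set (plane R)) (z : plane R) : measurable B ->
  area R (B `&` box z s) = (area R (B `&` box z s `\` box x r)
    + area R (B `&` box z s `&` box x r))%E.
Proof.
move=> mB; rewrite -measureDI//; last exact: measurable_box.
by apply: measurableI => //; exact: measurable_box.
Qed.

Let outside (z : plane R) : r < 4^-1 -> s <= 4^-1 -> centered_cell z ->
  A' `&` box z s `\` box x r = A `&` box z s `\` box x r.
Proof.
move=> r_lt s_le /unit_squareE/= zb.
apply/seteqP; split=> y [[Ay /boxE yb] yn]; split=> //; split;
  try exact/boxE; move: Ay.
  rewrite /A' /preimage /= (rotate_lift_local r_lt); last by apply/boxE; lra.
  by case: ifP => // /andP[/= h1 h2]; exfalso; apply: yn; apply/boxE; lra.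
rewrite /A' /preimage /= (rotate_lift_local r_lt); last by apply/boxE; lra.
by case: ifP => // /andP[/= h1 h2]; exfalso; apply: yn; apply/boxE; lra.
Qed.

(** The box contains the turned square: the mass outside that square is untouched, and the mass
    inside is moved by the measure-preserving [rot]. *)
Lemma density_rotate_surround (z : plane R) :
  r < 4^-1 -> s <= 4^-1 -> centered_cell z -> r <= s ->
  box x (s - r) z -> density A' s z = density A s z.
Proof.
move=> r_lt s_le zb rs /boxE zx.
rewrite /density (area_split z mA') (area_split z mA) outside//.
have mI : measurable (A `&` box x r).
  by apply: measurableI => //; exact: measurable_box.
have e (B : set (plane R)) : B `&` box z s `&` box x r = B `&` box x r.
  apply/seteqP; split=> y [] => [[By _]|By] /boxE yb; split=> //; try exact/boxE.
  by split=> //; apply/boxE; lra.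
have eA : A' `&` box x r = rot @^-1` (A `&` box x r).
  apply/seteqP; split=> y [Ay /boxE yb]; split=> //; move: Ay; rewrite /A' /preimage /=.
  - rewrite (rotate_lift_local r_lt) ?ifT//; last by apply/boxE; lra.
    by rewrite /in_square /=; lra.
  - by move=> _; apply/boxE; rewrite /rot /=; lra.
  - rewrite (rotate_lift_local r_lt) ?ifT//; last first.
      by move/boxE: yb; rewrite /rot /= => yb; apply/boxE; lra.
    by move/boxE: yb; rewrite /rot /in_square /=; lra.
  - by move=> _; apply/boxE; move/boxE: yb; rewrite /rot /=; lra.
rewrite !e eA; have -> // : area R (rot @^-1` (A `&` box x r)) = area R (A `&` box x r).
exact: (measure_preserving_rot.2 _ mI).
Qed.

(** The sets differ only inside the turned square, which contributes at most its own area. [B] and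
    [B'] are kept general so that the bound can be used in both directions. *)
Lemma area_rotate_le (B B' : set (plane R)) (z : plane R) :
  0 < r -> measurable B -> measurable B' ->
  B' `&` box z s `\` box x r = B `&` box z s `\` box x r ->
  fine (area R (B' `&` box z s)) <= fine (area R (B `&` box z s)) + 4 * r ^+ 2.
Proof.
move=> r_gt0 mB mB' e.
have fB := fin_num_area_box z s mB; have fB' := fin_num_area_box z s mB'.
rewrite -lee_fin EFinD !fineK// (area_split z mB') e -(area_box x (ltW r_gt0)).
apply: leeD; apply: le_measure; rewrite ?inE; try exact: measurable_box.
- by apply: measurableD; [apply: measurableI|] => //; exact: measurable_box.
- by apply: measurableI => //; exact: measurable_box.
- exact: subDsetl.
- by apply: measurableI; [apply: measurableI|] => //; exact: measurable_box.
- exact: subIsetr.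
Qed.

Lemma density_rotate_near (z : plane R) :
  0 < r -> r < 4^-1 -> 0 < s -> s <= 4^-1 -> centered_cell z ->
  `|density A' s z - density A s z| <= r ^+ 2 / s ^+ 2.
Proof.
move=> r_gt0 r_lt s_gt0 s_le zb; have s2 : 0 < s ^+ 2 by rewrite exprn_gt0.
have h1 := area_rotate_le r_gt0 mA mA' (outside r_lt s_le zb).
have h2 := area_rotate_le r_gt0 mA' mA (esym (outside r_lt s_le zb)).
rewrite /density -mulrBl normrM (gtr0_norm (_ : 0 < (4 * s ^+ 2)^-1)); last first.
  by rewrite invr_gt0 mulr_gt0.
rewrite ler_pdivrMr; last by rewrite mulr_gt0.
rewrite (_ : _ / _ * _ = 4 * r ^+ 2); last by field; lra.
by rewrite ler_norml; lra.
Qed.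

(** The cell is split into the box [N] about [x] and the rest. The integral over [N] is unchanged;
    outside [N] the integrand can grow only on [M], and there by at most [k]. *)
Lemma mixing_cost_rotate : lattice_periodic A -> 0 < r -> r < 4^-1 ->
  0 < s -> s <= 4^-1 ->
  (mixing_cost A' s <=
   mixing_cost A s + (Num.min 1 (r ^+ 2 / s ^+ 2) * (16 * r * s))%:E)%E.
Proof.
move=> pA r_gt0 r_lt s_gt0 s_le.
have pA' : lattice_periodic A'.
  by move=> m n z; rewrite /A' /preimage /mkset rotate_liftDz pA.
pose a : plane R := (x.1 - 2^-1, x.2 - 2^-1).
rewrite (mixing_cost_unit_square a mA pA s_gt0) (mixing_cost_unit_square a mA' pA' s_gt0).
set U := unit_square a; set g := cost_density A s; set g' := cost_density A' s.
pose N := box x `|r - s|; pose M := box x (r + s) `\` N.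
set k := Num.min _ _.
have k_ge0 : 0 <= k by rewrite le_min ler01 divr_ge0 ?sqr_ge0.
have mU : measurable U by exact: measurable_unit_square.
have mN : measurable N by exact: measurable_box.
have mM : measurable M by apply: measurableD => //; exact: measurable_box.
have mUN : measurable (U `\` N) by exact: measurableD.
have g_ge0 z : (0 <= g z)%E by exact: cost_density_ge0.
have g'_ge0 z : (0 <= g' z)%E by exact: cost_density_ge0.
have mg : measurable_fun setT g by exact: measurable_cost_density.
have mg' : measurable_fun setT g' by exact: measurable_cost_density.
have r_s : `|r - s| < 4^-1 by rewrite ltr_norml; lra.
have NU : N `<=` U by move=> z /boxE zN; apply/unit_squareE => /=; lra.
have split_U (f : plane R -> \bar R) : measurable_fun setT f -> (forall z, 0 <= f z)%E ->
    (\int[area R]_(z in U) f z = \int[area R]_(z in N) f z +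
     \int[area R]_(z in U `\` N) f z)%E.
  move=> mf f0; rewrite -ge0_integral_setU ?setDUK//.
    exact: measurable_funS mf.
  by rewrite disj_set2E setDIK.
have combine (X Y a1 a2 b1 b2 c : \bar R) :
    (Y = a2 + b2 -> X = a1 + b1 -> a2 = a1 -> b2 <= b1 + c -> Y <= X + c)%E.
  by move=> -> -> -> h; rewrite -addeA; exact: leeD2l.
apply: (combine _ _ _ _ _ _ _ (split_U g' mg' g'_ge0) (split_U g mg g_ge0)).
  rewrite /N.
  (* For [s <= r] the densities on [N] are permuted by [rot], which preserves their integral; for
     [r < s] they agree pointwise. *)
  have [sr|rs] := leP s r.
    have -> : `|r - s| = r - s by rewrite ger0_norm// subr_ge0.
    have rotx : rot x = x by rewrite /rot !subrr addr0 subr0 -surjective_pairing.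
    have mb := measurable_box x (r - s).
    have mgb : measurable_fun (box x (r - s)) g by exact: measurable_funS mg.
    rewrite -[RHS](ge0_integral_measure_preserving measure_preserving_rot mb mgb g_ge0).
    rewrite -[in RHS]rotx rot_box; apply: eq_integral => z; rewrite inE => zN.
    by rewrite /g' /cost_density density_rotate_inside.
  apply: eq_integral => z; rewrite inE => zN.
  rewrite /g' /cost_density density_rotate_surround//; [exact: NU|exact: ltW|].
  by move: zN; rewrite distrC ger0_norm// subr_ge0 ltW.
apply: (@le_trans _ _ (\int[area R]_(z in U `\` N) (g z + (k * \1_M z)%:E))%E).
  apply: ge0_le_integral => //.
  - exact: measurable_funS mg'.
  - apply: emeasurable_funD; first exact: measurable_funS mg.
    apply/measurable_EFinP; exact: measurable_funM.
  move=> z [zU zN]; rewrite /g /g' /cost_density -EFinD lee_fin.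
  have d0 := density_ge0 A s z; have d1 := density_le1 z mA s_gt0.
  have d0' := density_ge0 A' s z; have d1' := density_le1 z mA' s_gt0.
  have [zM|zM] := pselect (M z); last first.
    rewrite indicE memNset// mulr0 addr0 density_rotate_far// => zb.
    by apply: zM.
  rewrite indicE mem_set// mulr1.
  apply: logistic_lipschitz; rewrite ?d0 ?d0'//.
  rewrite le_min density_rotate_near// andbT.
  by apply: dist_unit_le1; rewrite ?d0 ?d0'.
rewrite ge0_integralD//; last 3 first.
- exact: measurable_funS mg.
- by move=> z _; rewrite lee_fin mulr_ge0.
- apply/measurable_EFinP; exact: measurable_funM.
apply: leeD; first exact: lexx.
under eq_integral do rewrite EFinM.
rewrite ge0_integralZl_EFin//; last by apply/measurable_EFinP; exact: measurable_indic.
rewrite integral_indic// EFinM; apply: lee_wpmul2l; first by rewrite lee_fin.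
apply: (@le_trans _ _ (area R M)).
  by apply: le_measure; rewrite ?inE//; exact: measurableI.
have NM : N `<=` box x (r + s).
  move=> z /boxE zN; apply/boxE.
  by have : `|r - s| <= r + s; [rewrite ler_norml; lra|lra].
have aM : area R (box x (r + s)) = (4 * (r + s) ^+ 2)%:E by rewrite area_box//; lra.
have fM : (area R (box x (r + s)) < +oo)%E by rewrite aM ltry.
rewrite (measureD (measurable_box _ _) mN fM) setIidr//=.
(* The area of [M] is [4 * (r + s) ^+ 2 - 4 * (r - s) ^+ 2 = 16 * r * s]. *)
rewrite aM area_box//.
by rewrite real_normK ?num_real// -EFinB lee_fin; lra.
Qed.

End rotation_cost.

(** * The cost of the initial square *)

Lemma logistic_le1 (R : realType) (a : R) : 0 <= a <= 1 -> a * (1 - a) <= 1.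
Proof. by move=> /andP[a0 a1]; rewrite mulr_ile1 ?subr_ge0 ?gerBl. Qed.

Section half_square.
Context (R : realType).
Implicit Types (A B : set (plane R)) (z y : plane R) (s t : R).

Lemma density_full A z s : 0 < s -> box z s `<=` A -> density A s z = 1.
Proof.
move=> s0 /setIidPr sA; rewrite /density sA area_box ?ltW//= divff//.
by rewrite gt_eqF// mulr_gt0// exprn_gt0.
Qed.

Lemma density_empty A z s : (forall y, box z s y -> ~ A y) -> density A s z = 0.
Proof.
move=> sA; rewrite /density (_ : A `&` _ = set0) ?measure0 ?mul0r//.
by apply/seteqP; split=> // y [Ay /sA].
Qed.

Lemma lattice_periodic_torus_pi (E : set (torus R)) :
  lattice_periodic (@torus_pi R @^-1` E).
Proof. by move=> m n z; rewrite /preimage /mkset torus_pi_addz. Qed.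

(** The square has centre (1/4, 1/4) and half-side 1/4, so one condition on centred offsets
    describes all its translates. *)
Lemma half_square_lift (y : plane R) : half_square (torus_pi y) <->
  in_square 4^-1 (centered (y.1 - 4^-1), centered (y.2 - 4^-1)).
Proof.
rewrite /in_square/=; split=> [[w [/=]]|/andP[h1 h2]].
  rewrite !in_itv/= => w1 w2 /esym/torus_piP[m [n ->]] /=.
  by rewrite !(addrAC _ _%:~R) !centeredDz !centered_id; lra.
have [m em] := centeredE (y.1 - 4^-1); have [n en] := centeredE (y.2 - 4^-1).
exists (4^-1 + centered (y.1 - 4^-1), 4^-1 + centered (y.2 - 4^-1)).
  by split; rewrite /= in_itv/=; lra.
apply/esym/torus_piP; exists m, n; rewrite [LHS]surjective_pairing /=.
by congr pair; rewrite -addrA -?em -?en addrC subrK.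
Qed.

Lemma measurable_half_square : measurable (@torus_pi R @^-1` @half_square R : set (plane R)).
Proof.
rewrite (_ : _ @^-1` _ =
  (fun y : plane R => centered (y.1 - 4^-1) : measurableTypeR R) @^-1` `](- 4^-1), 4^-1[%classic
  `&` (fun y : plane R => centered (y.2 - 4^-1) : measurableTypeR R) @^-1` `](- 4^-1), 4^-1[%classic).
  apply: measurableI; apply: measurable_preimage; try exact: measurable_itv.
    by apply: measurableT_comp => //; [exact: measurable_centered|exact: measurable_funB].
  by apply: measurableT_comp => //; [exact: measurable_centered|exact: measurable_funB].
apply/seteqP; split=> y /=; rewrite !in_itv/=.
  by move/half_square_lift/andP.
by move=> h; apply/half_square_lift/andP.
Qed.

Lemma centered_quarter t : 0 < t < 1 ->
  (- 4^-1 < centered (t - 4^-1) < 4^-1) = (t < 2^-1).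
Proof.
move=> t01; apply/idP/idP => h; last by rewrite centered_id; lra.
have [n en] := centeredE (t - 4^-1).
have n_lt1 : n < 1 by rewrite -(ltr_int R); lra.
have n_gtN1 : -1 < n by rewrite -(ltr_int R); lra.
have n0 : n = 0 by lia.
by move: en; rewrite n0 addr0; lra.
Qed.

Lemma half_square_local (y : plane R) : 0 < y.1 < 1 -> 0 < y.2 < 1 ->
  half_square (torus_pi y) <-> (y.1 < 2^-1) && (y.2 < 2^-1).
Proof. by move=> y1 y2; rewrite half_square_lift /in_square/= !centered_quarter. Qed.

(** Coordinates within [s] of 0, 1/2 or 1, where the edges of the half square lie; the lengths s, 2
    s and s add up to 4 s. *)
Let near_edges s : set (measurableTypeR R) :=
  `[0, s]%classic `|` `[2^-1 - s, 2^-1 + s]%classic `|` `[1 - s, 1]%classic.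

Let measurable_near_edges s : measurable (near_edges s).
Proof. by do 2 (apply: measurableU; last exact: measurable_itv); exact: measurable_itv. Qed.

Let length_near_edges s : 0 < s -> (lebesgue_measure (near_edges s) <= (4 * s)%R%:E)%E.
Proof.
move=> s0.
have h : (@lebesgue_measure R `[0%R, s]%classic +
    @lebesgue_measure R `[(2^-1 - s)%R, (2^-1 + s)%R]%classic +
    @lebesgue_measure R `[(1 - s)%R, 1%R]%classic <= (4 * s)%R%:E)%E.
  rewrite !lebesgue_measure_itv/= !lte_fin s0.
  by rewrite !ifT; [rewrite -?EFinD lee_fin; lra|lra|lra].
apply: le_trans h; apply: (le_trans (measureU2 _ _ _)) => /=.
- by apply: measurableU; exact: measurable_itv.
- exact: measurable_itv.
by apply: leeD; [apply: measureU2; exact: measurable_itv|exact: lexx].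
Qed.

(** Off the strips [B] a box lies in the half square or misses it, so the density is 1 or 0 and the
    cost vanishes. On [B] the cost is at most 1, and the vertical and the horizontal strips have
    area at most 4 s each. *)
Lemma mixing_cost_half_square s : 0 < s ->
  (mixing_cost (@torus_pi R @^-1` @half_square R) s <= (8 * s)%:E)%E.
Proof.
move=> s0; set H := _ @^-1` _; have mH : measurable H by exact: measurable_half_square.
pose I : set (measurableTypeR R) := `[0, 1[%classic.
have mI : measurable I by exact: measurable_itv.
pose B : set (plane R) := near_edges s `*` I `|` I `*` near_edges s.
have mB : measurable B by apply: measurableU; apply: measurableX.
have mF := @measurable_fundamental_square R.
apply: (@le_trans _ _ (\int[area R]_(z in @fundamental_square R) (\1_B z)%:E)%E).
  apply: ge0_le_integral => //.
  - by move=> z _; exact: cost_density_ge0.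
  - exact: measurable_funS (measurable_cost_density s mH).
  - by apply/measurable_EFinP; exact: measurable_indic.
  move=> z [/= z1 z2]; rewrite /cost_density lee_fin.
  have d0 := density_ge0 H s z; have d1 := density_le1 z mH s0.
  have [zB|zB] := pselect (B z); first by rewrite indicE mem_set// logistic_le1// d0.
  rewrite indicE memNset//.
  have [zn1 zn2] : ~ near_edges s z.1 /\ ~ near_edges s z.2.
    by split=> zn; apply: zB; [left|right].
  (* A coordinate away from the edges keeps its whole interval of radius [s] inside ]0, 1[ and on
     one side of 1/2. *)
  have apart t : I t -> ~ near_edges s t -> s < t < 2^-1 - s \/ 2^-1 + s < t < 1 - s.
    rewrite /I /near_edges /= !in_itv/= => /andP[t0 t1] /not_orP[/not_orP[h1 h2] h3].
    have {}h1 : s < t by rewrite ltNge; apply/negP => h; apply: h1; rewrite t0 h.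
    have {}h3 : t < 1 - s by rewrite ltNge; apply/negP => h; apply: h3; rewrite h ltW.
    have [h4|h4] := ltP t (2^-1 - s); [by left; apply/andP|right].
    by apply/andP; split=> //; rewrite ltNge; apply/negP => h; apply: h2; apply/andP.
  have {}z1 := apart _ z1 zn1; have {}z2 := apart _ z2 zn2.
  have [z12|z12] := boolP ((z.1 < 2^-1) && (z.2 < 2^-1)).
    rewrite density_full// ?subrr ?mulr0// => y /boxE yb.
    by apply/half_square_local; lra.
  rewrite density_empty ?mul0r// => y /boxE yb /half_square_local h.
  have : (y.1 < 2^-1) && (y.2 < 2^-1) by apply: h; lra.
  lra.
rewrite integral_indic//.
have l1 := length_near_edges s0.
apply: (@le_trans _ _ (area R B)).
  by apply: le_measure; rewrite ?inE//; exact: measurableI.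
have mE := measurable_near_edges s.
apply: (le_trans (measureU2 _ _ _)) => /=; [exact: measurableX..|].
have II : @lebesgue_measure R I = 1%E.
  by rewrite lebesgue_measure_itv/= lte_fin ltr01 -EFinB subr0.
rewrite !product_measure1E//= II mule1 mul1e.
by rewrite (_ : 8 * s = 4 * s + 4 * s) ?EFinD ?leeD//; ring.
Qed.

End half_square.

(** * Mixed sets *)

Section mixed_density.
Context (R : realType).
Implicit Types (A B : set (plane R)) (y z : plane R) (s : R).

Lemma measurable_torusP (E : set (torus R)) :
  measurable E <-> measurable (@torus_pi R @^-1` E : set (plane R)).
Proof.
split=> [|mE]; first exact: (measurable_preimage (@measurable_torus_pi R)).
by rewrite /measurable /= /torus_measurable /image_set_system /= setTI.
Qed.

(** Periodicity lets the measure be computed on any unit cell, in particular on one centred at a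
    given ball. *)
Lemma torus_measureE (E : set (torus R)) (a : plane R) :
  measurable E ->
  torus_measure E = area R (@torus_pi R @^-1` E `&` unit_square a).
Proof.
move=> mE; rewrite /torus_measure /pushforward /mrestr.
rewrite area_unit_square//; first exact/measurable_torusP.
exact: lattice_periodic_torus_pi.
Qed.

(** A lift of the difference shorter than 1/2 has both coordinates of size below 1/2, hence is the
    centred one; conversely the centred lift competes in the infimum. *)
Lemma torus_ball_lift (y z : plane R) (e : R) : e < 2^-1 ->
  torus_ball (torus_pi z) e (torus_pi y) <->
  euclidean_norm (centered (y.1 - z.1), centered (y.2 - z.2)) < e.
Proof.
move=> e2; have norm_ge (u : R * R) : `|u.1| <= euclidean_norm u /\ `|u.2| <= euclidean_norm u.
  by rewrite /euclidean_norm -!sqrtr_sqr !ler_wsqrtr// ?lerDl ?lerDr sqr_ge0.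
have [m em] := centeredE (y.1 - z.1); have [n en] := centeredE (y.2 - z.2).
rewrite /torus_ball /= /torus_dist -torus_piB.
set S := [set euclidean_norm v | v in _].
have Sc : S (euclidean_norm (centered (y.1 - z.1), centered (y.2 - z.2))).
  exists (centered (y.1 - z.1), centered (y.2 - z.2)) => //=.
  apply/esym/torus_piP; exists m, n; rewrite [LHS]surjective_pairing.
  by congr pair.
have lbS : lbound S 0 by move=> _ [v _ <-]; exact: sqrtr_ge0.
split=> [lt_e|]; last first.
  by move=> h; exact: le_lt_trans (ge_inf (ex_intro _ 0 lbS) Sc) h.
have [_ [v /= vE <-] ve] := inf_lt (ex_intro _ _ Sc) lt_e.
move: vE => /torus_piP[m' [n' ev]].
have [v1 v2] := norm_ge v.
have ce (t : R) : `|t| < e -> centered t = t.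
  by rewrite ltr_norml => te; apply: centered_id; lra.
have c1 : centered (y.1 - z.1) = v.1.
  rewrite -(centeredDz _ m') (_ : _ + _ = v.1); last by rewrite ev.
  exact: ce (le_lt_trans v1 ve).
have c2 : centered (y.2 - z.2) = v.2.
  rewrite -(centeredDz _ n') (_ : _ + _ = v.2); last by rewrite ev.
  exact: ce (le_lt_trans v2 ve).
by rewrite c1 c2 -surjective_pairing.
Qed.

Lemma measurable_torus_ball (z : plane R) (e : R) : 0 < e -> e < 2^-1 ->
  measurable (torus_ball (torus_pi z) e).
Proof.
move=> e0 e2; apply/measurable_torusP.
pose f (y : plane R) : measurableTypeR R := centered (y.1 - z.1) ^+ 2 + centered (y.2 - z.2) ^+ 2.
have mf : measurable_fun setT f.
  apply: measurable_funD; apply: measurable_funX;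
    apply: measurableT_comp; by [exact: measurable_centered|exact: measurable_funB].
rewrite (_ : _ @^-1` _ = f @^-1` `]-oo, e ^+ 2[%classic).
  by apply: measurable_preimage => //; exact: measurable_itv.
have eE y : (Num.sqrt (f y) < e) = (f y < e ^+ 2).
  by rewrite -[X in _ < X](gtr0_norm e0) -sqrtr_sqr ltr_sqrt// exprn_gt0.
apply/seteqP; split=> y /=.
  by move/(torus_ball_lift y z e2); rewrite /euclidean_norm/= eE in_itv.
by rewrite in_itv/= -eE => h; apply/(torus_ball_lift y z e2).
Qed.

(** Turns lower bounds for the complement into upper bounds for the set. *)
Lemma density_setC A z s : 0 < s -> measurable A ->
  density (~` A) s z = 1 - density A s z.
Proof.
move=> s0 mA; have mb := measurable_box z s.
have s2 : 4 * s ^+ 2 != 0 by rewrite gt_eqF// mulr_gt0// exprn_gt0.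
have fA := fin_num_area_box z s mA.
have fC := fin_num_area_box z s (measurableC mA).
have e : (4 * s ^+ 2)%:E = (area R (~` A `&` box z s) + area R (A `&` box z s))%E.
  by rewrite -(area_box z (ltW s0)) setIC -setDE [in X in (_ + X)%E]setIC; exact: measureDI.
rewrite /density; apply: (mulIf s2); rewrite mulrBl !divfK// mul1r.
by apply/eqP; rewrite -subr_eq opprK eq_sym; apply/eqP; rewrite -fineD// -e.
Qed.

(** The disc lies between the boxes of half-sides [eps / 2] and [eps], so it covers at least a
    quarter of the larger one; hence the factor 4. *)
Lemma mixed_density (kappa eps : R) (E : set (torus R)) (z : plane R) :
  0 < kappa -> 0 < eps < 4^-1 -> mixed kappa eps E ->
  kappa / 4 <= density (@torus_pi R @^-1` E) eps z <= 1 - kappa / 4.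
Proof.
move=> k0 /andP[eps0 eps4] [mE /(_ (torus_pi z))].
set A : set (plane R) := _ @^-1` E; have mA : measurable A by exact/measurable_torusP.
have mB := @measurable_torus_ball z eps eps0 ltac:(lra).
(* In the cell centred at [z] the centred offsets from [z] are plain differences. *)
pose a : plane R := (z.1 - 2^-1, z.2 - 2^-1).
have mEB : measurable (E `&` torus_ball (torus_pi z) eps) by exact: measurableI.
rewrite (torus_measureE a mEB) (torus_measureE a mB).
set B : set (plane R) := @torus_pi R @^-1` (torus_ball (torus_pi z) eps) `&` unit_square a.
have -> : @torus_pi R @^-1` (E `&` torus_ball (torus_pi z) eps) `&` unit_square a = A `&` B.
  by rewrite preimage_setI -setIA.
have mBp : measurable B.
  by apply: measurableI; [exact/measurable_torusP|exact: measurable_unit_square].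
have Bbox : B `<=` box z eps.
  move=> y [/(torus_ball_lift y z) + /unit_squareE/= ya].
  move=> /(_ ltac:(lra)); rewrite !centered_id; [|lra..].
  rewrite /euclidean_norm /= => h; apply/boxE.
  have h1 : `|y.1 - z.1| < eps.
    by apply: le_lt_trans h; rewrite -sqrtr_sqr ler_wsqrtr// lerDl sqr_ge0.
  have h2 : `|y.2 - z.2| < eps.
    by apply: le_lt_trans h; rewrite -sqrtr_sqr ler_wsqrtr// lerDr sqr_ge0.
  by move: h1 h2; rewrite !ltr_norml; lra.
have boxB : box z (eps / 2) `<=` B.
  move=> y /boxE yb; split; last by apply/unit_squareE => /=; lra.
  have e2 : eps < 2^-1 by lra.
  apply/(torus_ball_lift y z e2); rewrite !centered_id; [|lra..].
  rewrite /euclidean_norm /= -[ltRHS](gtr0_norm eps0) -sqrtr_sqr ltr_sqrt ?exprn_gt0//.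
  have sq (t : R) : - (eps / 2) < t -> t < eps / 2 -> t ^+ 2 <= eps ^+ 2 / 4.
    move=> t1 t2; rewrite -subr_ge0 (_ : _ - _ = (eps / 2 - t) * (eps / 2 + t)).
      by rewrite mulr_ge0//; lra.
    by field.
  have ee : 0 < eps ^+ 2 by rewrite exprn_gt0.
  have q1 := sq (y.1 - z.1) ltac:(lra) ltac:(lra).
  have q2 := sq (y.2 - z.2) ltac:(lra) ltac:(lra).
  by move: ee q1 q2; lra.
have e2 : 0 < eps ^+ 2 by rewrite exprn_gt0.
have aboxz : area R (box z eps) = (4 * eps ^+ 2)%:E by rewrite area_box ?ltW.
have fsub (X : set (plane R)) : measurable X -> X `<=` box z eps -> area R X \is a fin_num.
  move=> mX /setIidl <-; exact: fin_num_area_box.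
have fB := fsub _ mBp Bbox.
have b_ge : eps ^+ 2 <= fine (area R B).
  have -> : eps ^+ 2 = fine (area R (box z (eps / 2))).
    by rewrite area_box ?divr_ge0 ?ltW//=; field.
  by apply: fine_area_le => //; exact: measurable_box.
have b_gt0 : 0 < fine (area R B) by apply: lt_le_trans b_ge.
have mAB : measurable (A `&` B) by exact: measurableI.
have fAB : area R (A `&` B) \is a fin_num by apply: fsub => // y [_ /Bbox].
rewrite ler_pdivlMr// ler_pdivrMr// => /andP[lo hi].
(* Stated for any [X], so that the complement of [A] gives the upper bound. *)
have part (X : set (plane R)) : measurable X ->
    kappa * fine (area R B) <= fine (area R (X `&` B)) -> kappa / 4 <= density X eps z.
  move=> mX h; rewrite /density ler_pdivlMr; last by rewrite mulr_gt0.
  rewrite (_ : _ * (4 * _) = kappa * eps ^+ 2); last by field.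
  apply: (le_trans (ler_wpM2l (ltW k0) b_ge)); apply: (le_trans h).
  apply: fine_area_le; first exact: measurableI.
  - by apply: measurableI => //; exact: measurable_box.
  - by move=> y [Xy /Bbox].
  - exact: fin_num_area_box.
apply/andP; split; first exact: part.
rewrite lerBrDl -lerBrDr -density_setC//; apply: part; first exact: measurableC.
have : fine (area R B) = fine (area R (~` A `&` B)) + fine (area R (A `&` B)).
  rewrite -fineD//; last first.
    by apply: fsub => [|y [_ /Bbox]//]; apply: measurableI => //; exact: measurableC.
  by congr fine; rewrite setIC -setDE [in X in (_ + X)%E]setIC; exact: measureDI.
by move: hi; rewrite mulrBl mul1r; lra.
Qed.

(** The doubled box contains four disjoint boxes of half-side [s], each holding at least [c] times
    its area. The cut lines between the open boxes may be dropped, as only a lower bound is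
    sought. *)
Lemma density_double A (c s : R) : measurable A -> 0 < s ->
  (forall z, c <= density A s z) -> forall z, c <= density A (2 * s) z.
Proof.
move=> mA s0 cA z; have s2 : 0 < 4 * s ^+ 2 by rewrite mulr_gt0// exprn_gt0.
have mb w t : measurable (A `&` box w t).
  by apply: measurableI => //; exact: measurable_box.
have quarter w : ((c * (4 * s ^+ 2))%:E <= area R (A `&` box w s))%E.
  rewrite -(fineK (fin_num_area_box w s mA)) lee_fin -ler_pdivlMr//.
  exact: cA.
have disj (X Y W : set (plane R)) (e e' : \bar R) :
    measurable X -> measurable Y -> measurable W ->
    X `&` Y = set0 -> X `<=` W -> Y `<=` W ->
    (e <= area R X -> e' <= area R Y -> e + e' <= area R W)%E.
  move=> mX mY mW XY XW YW eX eY.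
  apply: (le_trans (leeD eX eY)); rewrite -measureU//.
  by apply: le_measure; rewrite ?inE; [exact: measurableU|exact: mW|rewrite subUset].
(* [side i] stacks two of the four boxes; the shifts [- s] and [s] give the left and the right
   half. *)
pose side (i : R) : set (plane R) :=
  A `&` (box (z.1 + i, z.2 - s) s `|` box (z.1 + i, z.2 + s) s).
have mside i : measurable (side i).
  by apply: measurableI => //; apply: measurableU; exact: measurable_box.
have half i : ((c * (4 * s ^+ 2))%:E + (c * (4 * s ^+ 2))%:E <= area R (side i))%E.
  apply: (disj (A `&` box (z.1 + i, z.2 - s) s) (A `&` box (z.1 + i, z.2 + s) s)) => //.
  - by apply/seteqP; split=> // y [[_ /boxE/= h1] [_ /boxE/= h2]]; lra.
  - by move=> y [Ay yb]; split=> //; left.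
  - by move=> y [Ay yb]; split=> //; right.
have whole : ((c * (4 * s ^+ 2))%:E + (c * (4 * s ^+ 2))%:E +
    ((c * (4 * s ^+ 2))%:E + (c * (4 * s ^+ 2))%:E)
    <= area R (A `&` box z (2 * s)))%E.
  apply: (disj (side (- s)) (side s)) => //.
  - apply/seteqP; split=> // y [[_ h1] [_ h2]].
    by case: h1 => /boxE/= h1; case: h2 => /boxE/= h2; lra.
  - by move=> y [Ay [] /boxE/= yb]; split=> //; apply/boxE; lra.
  - by move=> y [Ay [] /boxE/= yb]; split=> //; apply/boxE; lra.
move: whole; rewrite -(fineK (fin_num_area_box z (2 * s) mA)) -!EFinD lee_fin => whole.
rewrite /density ler_pdivlMr; last by rewrite mulr_gt0// exprn_gt0// mulr_gt0.
by apply: le_trans whole; rewrite exprMn; lra.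
Qed.

Lemma density_ge_scales A (c s : R) (j : nat) : measurable A -> 0 < s ->
  (forall z, c <= density A s z) -> forall z, c <= density A (2 ^+ j * s) z.
Proof.
move=> mA s0 cA; elim: j => [|j IH]; first by rewrite expr0 mul1r.
by rewrite exprS -mulrA; apply: density_double => //; rewrite mulr_gt0// exprn_gt0.
Qed.

Lemma mixing_cost_ge A (c s : R) : measurable A -> 0 <= c -> 0 < s ->
  (forall z, c <= density A s z <= 1 - c) -> ((c ^+ 2)%:E <= mixing_cost A s)%E.
Proof.
move=> mA c0 s0 cA; have mF := @measurable_fundamental_square R.
have aF : area R (@fundamental_square R) = 1%E.
  rewrite /fundamental_square product_measure1E//= !lebesgue_measure_itv/= lte_fin ltr01.
  by rewrite -EFinB subr0 mule1.
rewrite -[leLHS]mule1 -aF -integral_cst//.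
apply: ge0_le_integral => //.
- by move=> z _; rewrite lee_fin sqr_ge0.
- exact: measurable_funS (measurable_cost_density s mA).
move=> z _; rewrite /cost_density lee_fin expr2; have /andP[h1 h2] := cA z.
by apply: ler_pM => //; lra.
Qed.

End mixed_density.

(** * Summation over scales and rotations *)

Section scales.
Context (R : realType).

(* The right-hand side is P(s) - P(s/2) for P(s) = 6rs/(r+s) <= 6r, so the sum
   over dyadic scales telescopes. *)
Lemma min_scale_le (r s : R) : 0 < r -> 0 < s ->
  Num.min 1 (r ^+ 2 / s ^+ 2) * s <= 6 * r * s / (r + s) - 6 * r * (s / 2) / (r + s / 2).
Proof.
move=> r0 s0; have h1 : 0 < r + s by lra.
have h2 : 0 < 2 * r + s by lra.
have -> : 6 * r * s / (r + s) - 6 * r * (s / 2) / (r + s / 2) =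
    6 * r ^+ 2 * s / ((r + s) * (2 * r + s)) by field; lra.
rewrite ler_pdivlMr; last by rewrite mulr_gt0.
(* The constant 6 is 2 times 3: with m the larger of [r] and [s], one has r + s <= 2 m and 2 r + s
   <= 3 m. *)
have [sr|rs] := leP s r.
  have m0 : 0 <= Num.min 1 (r ^+ 2 / s ^+ 2) <= 1.
    by rewrite le_min ler01 divr_ge0 ?sqr_ge0//= ge_min lexx.
  apply: (@le_trans _ _ (1 * s * ((r + s) * (2 * r + s)))).
    apply: ler_wpM2r; first by rewrite mulr_ge0 ?ltW.
    by apply: ler_wpM2r; [exact: ltW|case/andP: m0].
  have h3 : (r + s) * (2 * r + s) <= (2 * r) * (3 * r) by apply: ler_pM; lra.
  rewrite mul1r mulrC; apply: ler_wpM2r; first exact: ltW.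
  by apply: le_trans h3 _; rewrite le_eqVlt; apply/orP; left; apply/eqP; ring.
apply: (@le_trans _ _ (r ^+ 2 / s ^+ 2 * s * ((r + s) * (2 * r + s)))).
  apply: ler_wpM2r; first by rewrite mulr_ge0 ?ltW.
  by apply: ler_wpM2r; [exact: ltW|rewrite ge_min lexx orbT].
have -> : r ^+ 2 / s ^+ 2 * s = r ^+ 2 / s by field; lra.
have h3 : (r + s) * (2 * r + s) <= (2 * s) * (3 * s) by apply: ler_pM; lra.
apply: (le_trans (ler_wpM2l _ h3)); first by rewrite divr_ge0 ?sqr_ge0// ltW.
by rewrite le_eqVlt; apply/orP; left; apply/eqP; field; lra.
Qed.

Lemma sum_scales_le (r e : R) (N : nat) : 0 < r -> 0 < e ->
  \sum_(j < N) Num.min 1 (r ^+ 2 / (2 ^+ j * e) ^+ 2) * (16 * r * (2 ^+ j * e))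
    <= 96 * r ^+ 2.
Proof.
(* [Q j] is 16 r P(2^j e / 2) with P(s) = 6rs/(r+s); halving the argument makes [Q j.+1] the value
   at scale 2^j e. Since [Q] stays between 0 and [96 * r ^+ 2], the telescoped bound is uniform in
   [N]. *)
move=> r0 e0; pose Q (j : nat) : R := 96 * r ^+ 2 * (2 ^+ j * e / 2) / (r + 2 ^+ j * e / 2).
have p0 (j : nat) : 0 < 2 ^+ j * e :> R by rewrite mulr_gt0// exprn_gt0.
have Q0 j : 0 <= Q j <= 96 * r ^+ 2.
  have := p0 j; rewrite /Q; set t := 2 ^+ j * e => t0.
  have r2 : 0 < 96 * r ^+ 2 by rewrite mulr_gt0// exprn_gt0.
  have rt : 0 < r + t / 2 by lra.
  rewrite divr_ge0/=; [|by rewrite mulr_ge0//; lra|lra].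
  by rewrite -mulrA ler_piMr// ?ler_pdivrMr// ?mul1r; lra.
apply: (@le_trans _ _ (\sum_(j < N) (Q j.+1 - Q j))).
  apply: ler_sum => j _; have := @min_scale_le r (2 ^+ j * e) r0 (p0 j).
  rewrite /Q (exprS (2 : R) j); set t := 2 ^+ j * e; set m := Num.min _ _ => h.
  have -> : m * (16 * r * t) = 16 * r * (m * t) by ring.
  apply: (le_trans (ler_wpM2l _ h)); first lra.
  have t0 : 0 < t by exact: p0.
  rewrite -/t (_ : 2 * 2 ^+ j * e / 2 = t); last by rewrite /t; field.
  by rewrite le_eqVlt; apply/orP; left; apply/eqP; field; lra.
rewrite -(big_mkord xpredT (fun j => Q j.+1 - Q j)) telescope_sumr//.
by have := Q0 N; have := Q0 0%N; lra.
Qed.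

Lemma sum_pow2 (e : R) (N : nat) :
  \sum_(j < N) 2 ^+ j * e = (2 ^+ N - 1) * e.
Proof.
elim: N => [|N IH]; first by rewrite big_ord0 expr0 subrr mul0r.
by rewrite big_ord_recr IH /= exprS; ring.
Qed.

(** [N] is taken least with [4^-1 < 2 ^+ N * e]. Minimality gives the first two bounds; the third
    follows from [e^-1 < 2 ^+ N * 4] with [2 <= expR 1] and [4 <= expR 3]. *)
Lemma log_scale (e : R) : 0 < e < 4^-1 -> exists N : nat,
  [/\ forall j, (j < N)%N -> 2 ^+ j * e <= 4^-1, 2 ^+ N * e <= 2^-1
    & ln e^-1 <= N%:R + 3].
Proof.
move=> /andP[e0 e4].
have exN : exists N, 4^-1 < 2 ^+ N * e.
  (* The witness exceeds 1/e, and 2^k > k. *)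
  exists (Num.trunc (e^-1)).+1; rewrite -ltr_pdivrMr//.
  apply: (@lt_trans _ _ e^-1); first by rewrite gtr_pMl ?invr_gt0//; lra.
  apply: (lt_trans (truncnS_gt _)).
  by rewrite -natrX ltr_nat ltn_expl.
case: (ex_minnP exN) => N N4 Nmin; exists N; split.
- by move=> j jN; rewrite leNgt; apply/negP => /Nmin; rewrite leqNgt jN.
- case: N N4 Nmin => [|N] N4 Nmin; first by rewrite mul1r; lra.
  have : 2 ^+ N * e <= 4^-1 by rewrite leNgt; apply/negP => /Nmin; rewrite ltnn.
  by rewrite exprS; lra.
rewrite -[leRHS]expRK ler_ln ?posrE ?invr_gt0 ?expR_gt0//.
have e3 : 4 <= expR 3 :> R by have := expR_ge1Dx (3 : R); lra.
have e1 : 2 <= expR 1 :> R by have := expR_ge1Dx (1 : R); lra.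
have eN : 2 ^+ N <= expR N%:R :> R 
  by rewrite -[N%:R in leRHS]mulr1 expRM_natl lerXn2r// ?nnegrE ?expR_ge0 ?ler0n.
rewrite expRD; apply: (@le_trans _ _ (2 ^+ N * 4)).
  rewrite -[leLHS]mul1r ler_pdivrMr//; lra.
by apply: ler_pM => //; rewrite ?exprn_ge0.
Qed.

End scales.

(** * Compositions of rotations *)

Section iterate.
Context (R : realType).
Local Notation lifted E := (@torus_pi R @^-1` E : set (plane R)).

(** The estimate [density_rotate_near] concerns centres in the cell about [x]; periodicity replaces
    [z] by its translate [w] in that cell. *)
Lemma density_rotate_le (A : set (plane R)) (x : plane R) (r s : R) (z : plane R) :
  measurable A -> lattice_periodic A -> 0 < r -> r < 4^-1 -> 0 < s -> s <= 4^-1 ->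
  density (rotate_lift (- 1) x r @^-1` A) s z <= density A s z + r ^+ 2 / s ^+ 2.
Proof.
move=> mA pA r0 r4 s0 s4.
have [m em] := centeredE (z.1 - x.1); have [n en] := centeredE (z.2 - x.2).
pose w : plane R := (x.1 + centered (z.1 - x.1), x.2 + centered (z.2 - x.2)).
have -> : z = (w.1 + m%:~R, w.2 + n%:~R).
  by rewrite [LHS]surjective_pairing /w/=; congr pair; rewrite -addrA -?em -?en addrC subrK.
have mA' : measurable (rotate_lift (- 1) x r @^-1` A).
  by apply: measurable_preimage => //; exact: measurable_rotate_lift.
have pA' : lattice_periodic (rotate_lift (- 1) x r @^-1` A).
  by move=> i j y; rewrite /preimage /mkset rotate_liftDz pA.
rewrite !density_periodic// -lerBlDl.
apply: (le_trans (ler_norm _)); apply: density_rotate_near => //.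
apply/unit_squareE => /=.
have := centered_ge (z.1 - x.1); have := centered_lt (z.1 - x.1).
have := centered_ge (z.2 - x.2); have := centered_lt (z.2 - x.2); lra.
Qed.

(** One induction carries both estimates: the pointwise density bound serves when [eps] is bounded
    below, the cost bound when [eps] is small. *)
Lemma rotations_effect (n : nat) (x : 'I_n -> torus R) (r : 'I_n -> R) (E : set (torus R)) :
  measurable E -> (forall i, 0 < r i < 4^-1) ->
  let E' := (\big[comp/id]_(i < n) rotate_square (x i) (r i)) @` E in
  [/\ measurable E',
    forall (s : R) z, 0 < s -> s <= 4^-1 ->
      density (lifted E') s z <= density (lifted E) s z + (\sum_(i < n) r i ^+ 2) / s ^+ 2
    & forall (N : nat) (e : R), 0 < e -> (forall j, (j < N)%N -> 2 ^+ j * e <= 4^-1) ->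
      (\sum_(j < N) mixing_cost (lifted E') (2 ^+ j * e) <=
       \sum_(j < N) mixing_cost (lifted E) (2 ^+ j * e) +
       (96 * \sum_(i < n) r i ^+ 2)%:E)%E].
Proof.
move=> mE; elim: n x r => [|n IH] x r hr /=.
  rewrite big_ord0 image_id big_ord0; split=> //.
    by move=> s z s0 s4; rewrite mul0r addr0.
  by move=> N e _ _; rewrite mulr0 adde0.
have [] := IH (fun i => x (lift ord0 i)) (fun i => r (lift ord0 i)) (fun i => hr _).
(* The rotation of index [ord0] is outermost and acts last; the induction hypothesis covers the
   inner ones, whose image is [E1]. *)
rewrite !big_ord_recl -image_comp.
set E1 := (\big[_/_]_(_ < _) _) @` E => mE1 dE1 cE1.
have /andP[r0 r4] := hr ord0.
have mA1 : measurable (lifted E1) by exact/measurable_torusP.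
have pA1 := @lattice_periodic_torus_pi R E1.
rewrite preimage_rotate_square//; split.
- apply/measurable_torusP; rewrite preimage_rotate_square//.
  by apply: measurable_preimage => //; exact: measurable_rotate_lift.
- move=> s z s0 s4.
  apply: (le_trans (density_rotate_le (repr (x ord0)) z mA1 pA1 r0 r4 s0 s4)).
  by rewrite mulrDl; have := dE1 s z s0 s4; lra.
move=> N e e0 eN; have p0 (j : nat) : 0 < 2 ^+ j * e :> R by rewrite mulr_gt0// exprn_gt0.
have combine (u v w : \bar R) (p q : R) :
    (v <= w + q%:E -> u <= v + p%:E -> u <= w + (p + q)%:E)%E.
  move=> vw uv; apply: (le_trans uv); rewrite (addrC p q) EFinD addeA.
  by apply: leeD; [exact: vw|exact: lexx].
rewrite mulrDr; apply: (combine _ _ _ _ _ (cE1 N e e0 eN)).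
apply: (@le_trans _ _ (\sum_(j < N) (mixing_cost (lifted E1) (2 ^+ j * e) +
  (Num.min 1 (r ord0 ^+ 2 / (2 ^+ j * e) ^+ 2) * (16 * r ord0 * (2 ^+ j * e)))%:E))%E).
  by apply: lee_sum => j _; apply: mixing_cost_rotate => //; exact: eN.
rewrite big_split/=; apply: leeD; first exact: lexx.
by rewrite sumEFin lee_fin; exact: sum_scales_le.
Qed.

End iterate.

(** * Choice of the constant and conclusion *)

Theorem theorem7p1 (R : realType) (kappa : R) (hkappa : 0 < kappa < 2^-1) :
  exists C : R, 0 < C /\
    forall (n : nat) (x : 'I_n -> torus R) (r : 'I_n -> R) (eps : R),
      (0 < n)%N ->
      (forall i, 0 < r i < 4^-1) ->
      0 < eps < 4^-1 ->
      mixed kappa eps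
        ((\big[comp/id]_(i < n) rotate_square (x i) (r i)) @` @half_square R) ->
      C^-1 * ln (eps^-1) <= \sum_(i < n) r i ^+ 2.
Proof.
have /andP[k0 k2] := hkappa; pose c := kappa / 4.
have c0 : 0 < c by rewrite divr_gt0.
have c2 : 0 < c ^+ 2 by rewrite exprn_gt0.
(* With L = ln(1/eps) and S the sum of squares, L c^2 <= 4 + 3 c^2 + 96 S. If L > T, the additive
   terms are below L c^2 / 2, so S >= L c^2 / 192. If L <= T, the second entry of [d] gives d L <= c
   exp(-2 T) <= c eps^2 <= S. *)
pose T := 2 * (4 + 3 * c ^+ 2) / c ^+ 2.
have T0 : 0 < T by rewrite divr_gt0//; lra.
pose d := Num.min (c ^+ 2 / 192) (c * expR (- (2 * T)) / T).
have d0 : 0 < d.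
  by rewrite lt_min divr_gt0//= divr_gt0// mulr_gt0// expR_gt0.
exists d^-1; split; first by rewrite invr_gt0.
move=> n x r eps _ hr heps hmix; rewrite invrK; have /andP[eps0 eps4] := heps.
have mH : measurable (@half_square R) by apply/measurable_torusP; exact: measurable_half_square.
have [mE dE cE] := rotations_effect x mH hr.
move: hmix mE dE cE; set E := _ @` _ => hmix mE dE cE.
set S := \sum_(i < n) _; set L := ln _.
have mA : measurable (@torus_pi R @^-1` E : set (plane R)) by exact/measurable_torusP.
have dens z := mixed_density z k0 heps hmix.
have e2 : 0 < eps ^+ 2 by rewrite exprn_gt0.
have small : c * eps ^+ 2 <= S.
  (* The centre of the square (1/2, 1)^2, which is disjoint from the half square; as [eps < 4^-1],
     the initial density there is 0. *)
  pose z : plane R := (3 / 4, 3 / 4).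
  have := dE eps z eps0 (ltW eps4).
  rewrite (@density_empty R (@torus_pi R @^-1` @half_square R)); last first.
    move=> y /boxE/= yb Hy.
    have [h _] := @half_square_local R y ltac:(lra) ltac:(lra).
    by have := h Hy; lra.
  rewrite add0r => h; rewrite -ler_pdivlMr//; apply: le_trans h.
  by have /andP[] := dens z.
have [N [Nle N2 NL]] := log_scale heps.
have large : N%:R * c ^+ 2 <= 4 + 96 * S.
  have := cE N eps eps0 Nle.
  have p0 (j : nat) : 0 < 2 ^+ j * eps :> R by rewrite mulr_gt0// exprn_gt0.
  have lo : ((N%:R * c ^+ 2)%:E <= \sum_(j < N) mixing_cost (@torus_pi R @^-1` E) (2 ^+ j * eps)%R)%E.
    apply: (@le_trans _ _ (\sum_(j < N) (c ^+ 2)%:E)%E).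
      by rewrite sumEFin lee_fin sumr_const card_ord mulr_natl.
    apply: lee_sum => j _; apply: mixing_cost_ge => //; first exact: ltW.
    move=> z; apply/andP; split.
      by apply: density_ge_scales => // w; have /andP[] := dens w.
    (* Doubling propagates lower bounds only, so the upper bound goes through the complement. *)
    rewrite lerBrDl -lerBrDr -density_setC//.
    apply: density_ge_scales => //; first exact: measurableC.
    by move=> w; rewrite density_setC// lerBrDl -lerBrDr; have /andP[] := dens w.
  have hi : (\sum_(j < N) mixing_cost (@torus_pi R @^-1` @half_square R) (2 ^+ j * eps)%R <= 4%:E)%E.
    apply: (@le_trans _ _ (\sum_(j < N) (8 * (2 ^+ j * eps))%:E)%E).
      by apply: lee_sum => j _; exact: mixing_cost_half_square.
    (* The geometric sum is at most [2 ^+ N * eps <= 2^-1], and 8 times 1/2 is 4. *)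
    by rewrite sumEFin lee_fin -mulr_sumr sum_pow2 mulrBl; lra.
  move=> h; rewrite -lee_fin EFinD; apply: (le_trans lo); apply: (le_trans h).
  by apply: leeD.
have [LT|TL] := leP L T.
  apply: (@le_trans _ _ (c * expR (- (2 * T)))).
    apply: (@le_trans _ _ (d * T)); first by rewrite ler_pM2l.
    by rewrite -ler_pdivlMr// ge_min lexx orbT.
  apply: le_trans small; rewrite ler_pM2l//.
  have -> : eps ^+ 2 = expR (- (2 * L)).
    by rewrite -mulrN expRM_natl /L lnV ?posrE// opprK lnK.
  by rewrite ler_expR lerN2 ler_pM2l.
apply: (@le_trans _ _ (c ^+ 2 / 192 * L)).
  by apply: ler_wpM2r; [exact: le_trans (ltW T0) (ltW TL)|rewrite ge_min lexx].
have : T * c ^+ 2 < L * c ^+ 2 by rewrite ltr_pM2r.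
rewrite /T divfK ?gt_eqF// => h1.
have h2 : L * c ^+ 2 <= (N%:R + 3) * c ^+ 2 by rewrite ler_pM2r.
by lra.
Qed.
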